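(* Let $\mathcal{C}$ be a Cauchy complete category and let $(\mathcal{C},\mathcal{D})$ be a display map category which models $\Sigma$-types and functorial $\mathrm{Id}$-types (i.e. models $\Sigma$-types and functorially models $\mathrm{Id}$-types). Let $\overline{\mathcal{D}} = ({}^{\square}\mathcal{D})^{\square}$. Then $(\mathcal{C},\overline{\mathcal{D}})$ is again a display map category which models $\Sigma$-types and functorial $\mathrm{Id}$-types. If $(\mathcal{C},\mathcal{D})$ also models $\Pi$-types, then $(\mathcal{C},\overline{\mathcal{D}})$ also models $\Pi$-types.
   Context: A category is Cauchy complete if every idempotent $e=e^2:C\to C$ splits, i.e. $e=ir$ with $r:C\to R$, $i:R\to C$ and $ri=1_R$. For a class $\mathcal{M}$ of morphisms of $\mathcal{C}$, ${}^{\square}\mathcal{M}$ is the class of morphisms having the left lifting property against all morphisms of $\mathcal{M}$, $\mathcal{M}^{\square}$ is the class of morphisms having the right lifting property against all morphisms of $\mathcal{M}$, and $\overline{\mathcal{M}} := ({}^{\square}\mathcal{M})^{\square}$. A display map category $(\mathcal{C},\mathcal{D})$ is a category $\mathcal{C}$ with a terminal object and a class $\mathcal{D}$ of morphisms of $\mathcal{C}$ (called display maps) such that: (1) $\mathcal{D}$ contains every isomorphism; (2) $\mathcal{D}$ contains every morphism whose codomain is a terminal object; (3) every pullback of every morphism of $\mathcal{D}$ (along any morphism of $\mathcal{C}$) exists; (4) $\mathcal{D}$ is stable under pullback. $(\mathcal{C},\mathcal{D})$ models $\Sigma$-types if $\mathcal{D}$ is closed under composition. $(\mathcal{C},\mathcal{D})$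 models $\Pi$-types if for every pair of composable display maps $g:W\to X$ and $f:X\to Y$ there is a display map $\Pi_f g$ with codomain $Y$ and bijections $\mathcal{C}/Y(y,\Pi_f g)\cong \mathcal{C}/X(f^*y,g)$ natural in $y\in\mathcal{C}/Y$, where $f^*y$ is the pullback of $y$ along $f$. Suppose $(\mathcal{C},\mathcal{D})$ models $\Sigma$-types. It models $\mathrm{Id}$-types if for every $f:X\to Y$ in $\mathcal{D}$: (1) the diagonal $\Delta_f:f\to f\times f$ in $\mathcal{C}/Y$ (where $f\times f: X\times_Y X\to Y$) has a factorization in $\mathcal{C}/Y$, $\Delta_f=\epsilon_f r_f$, with $r_f:X\to \mathrm{Id}(f)$, $\epsilon_f:\mathrm{Id}(f)\to X\times_Y X$, and $\iota_f:\mathrm{Id}(f)\to Y$ the structure map; such that (2) $\epsilon_f\in\mathcal{D}$; and (3) for every morphism $\alpha:A\to X$ of $\mathcal{C}$ and each $i=0,1$, the morphism $\alpha^*r_f:A\to\alpha^*\mathrm{Id}(f)$ is in ${}^{\square}\mathcal{D}$, where $\pi_0,\pi_1:X\times_Y X\to X$ are the projections, $\alpha^*\mathrm{Id}(f)$ is the pullback of $\pi_i\epsilon_f:\mathrm{Id}(f)\to X$ along $\alpha$, and $\alpha^*r_f$ is the pullback along $\alpha$ of $r_f$ regarded as a morphism $1_X\to\pi_i\epsilon_f$ of $\mathcal{C}/X$. For an object $Y$, $\mathcal{D}/Y$ is the full subcategory of $\mathcal{C}/Y$ on the display maps, and $\mathcal{F}$ is the category $\bullet\to\bullet\to\bullet$,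 so $(\mathcal{D}/Y)^{\mathcal{F}}$ is the category of composable pairs of morphisms of $\mathcal{D}/Y$. $(\mathcal{C},\mathcal{D})$ functorially models $\mathrm{Id}$-types (models functorial $\mathrm{Id}$-types) if it models $\mathrm{Id}$-types and for each object $Y$ there is a functor $\mathcal{D}/Y\to(\mathcal{D}/Y)^{\mathcal{F}}$ which provides the factorizations $f\xrightarrow{r_f}\iota_f\xrightarrow{\epsilon_f}f\times f$ of part (1) (satisfying (2) and (3)); that is, it is a functorial factorization of the diagonals, acting on a morphism $h:f\to g$ of $\mathcal{D}/Y$ with outer components $h$ and $h\times h$. *)

(* Defs.v *)
From Stdlib Require Import ProofIrrelevance.
From Corelib Require Import ssreflect ssrfun.

Set Implicit Arguments.
Unset Strict Implicit.
Unset Printing Implicit Defensive.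

Declare Scope cat_scope.
Delimit Scope cat_scope with cat.
Local Open Scope cat_scope.

Record Category := MkCategory {
  Ob :> Type;
  Hom : Ob -> Ob -> Type;
  idm : forall X, Hom X X;
  comp : forall X Y Z, Hom Y Z -> Hom X Y -> Hom X Z;
  comp_idl : forall X Y (f : Hom X Y), comp (idm Y) f = f;
  comp_idr : forall X Y (f : Hom X Y), comp f (idm X) = f;
  comp_assoc : forall W X Y Z (h : Hom Y Z) (g : Hom X Y) (f : Hom W X),
    comp h (comp g f) = comp (comp h g) f }.

Arguments Hom {c} X Y.
Arguments idm {c} X.
Arguments comp {c X Y Z} g f.
Notation "g ∘ f" := (comp g f) (at level 40, left associativity) : cat_scope.

(* The object part of a functor is kept as a parameter, so that a functor can
   be required to have a prescribed value on objects without equating objects. *)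
Record FunctorOn (C E : Category) (F : C -> E) := MkFunctorOn {
  fmor : forall X Y, Hom X Y -> Hom (F X) (F Y);
  fmor_id : forall X, fmor (idm X) = idm (F X);
  fmor_comp : forall X Y Z (g : Hom Y Z) (f : Hom X Y),
    fmor (g ∘ f) = fmor g ∘ fmor f }.

Arguments fmor {C E F} _ {X Y} h.

Section Morphisms.
Variable C : Category.

Definition is_terminal (T : C) : Prop :=
  forall X : C, exists t : Hom X T, forall t', t' = t.

Definition is_iso (X Y : C) (f : Hom X Y) : Prop :=
  exists g : Hom Y X, g ∘ f = idm X /\ f ∘ g = idm Y.

Definition cauchy_complete : Prop :=
  forall (X : C) (e : Hom X X), e ∘ e = e ->
  exists (R : C) (r : Hom X R) (i : Hom R X), e = i ∘ r /\ r ∘ i = idm R.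

Definition MorClass := forall X Y : C, Hom X Y -> Prop.

Definition has_lifts (A B X Y : C) (l : Hom A B) (m : Hom X Y) : Prop :=
  forall (u : Hom A X) (v : Hom B Y), m ∘ u = v ∘ l ->
  exists d : Hom B X, d ∘ l = u /\ m ∘ d = v.

Definition llp (M : MorClass) : MorClass :=
  fun A B l => forall (X Y : C) (m : Hom X Y), M X Y m -> has_lifts l m.

Definition rlp (M : MorClass) : MorClass :=
  fun X Y m => forall (A B : C) (l : Hom A B), M A B l -> has_lifts l m.

Definition closure (M : MorClass) : MorClass := rlp (llp M).

(* For f : X -> Z, the map pb_fst of [Pullback f g] is the pullback of g
   along f. *)
Record Pullback (X Y Z : C) (f : Hom X Z) (g : Hom Y Z) := MkPullback {
  pb_ob : C;
  pb_fst : Hom pb_ob X;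
  pb_snd : Hom pb_ob Y;
  pb_sq : f ∘ pb_fst = g ∘ pb_snd;
  pb_lift : forall (W : C) (a : Hom W X) (b : Hom W Y),
    f ∘ a = g ∘ b -> Hom W pb_ob;
  pb_lift_fst : forall W (a : Hom W X) (b : Hom W Y) (e : f ∘ a = g ∘ b),
    pb_fst ∘ pb_lift e = a;
  pb_lift_snd : forall W (a : Hom W X) (b : Hom W Y) (e : f ∘ a = g ∘ b),
    pb_snd ∘ pb_lift e = b;
  pb_ext : forall W (h k : Hom W pb_ob),
    pb_fst ∘ h = pb_fst ∘ k -> pb_snd ∘ h = pb_snd ∘ k -> h = k }.

Lemma id_pullback_snd (X Z W : C) (f : Hom X Z) (a : Hom W X) (b : Hom W Z) :
  f ∘ a = idm Z ∘ b -> f ∘ a = b.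
Proof. by rewrite comp_idl. Qed.

Lemma id_pullback_sq (X Z : C) (f : Hom X Z) : f ∘ idm X = idm Z ∘ f.
Proof. by rewrite comp_idl comp_idr. Qed.

(* The identity of X, as the pullback of the identity of Z along f. *)
Definition id_pullback (X Z : C) (f : Hom X Z) : Pullback f (idm Z).
Proof.
refine (@MkPullback X Z Z f (idm Z) X (idm X) f (id_pullback_sq f)
          (fun W a b _ => a) _ _ _).
- by move=> W a b _; exact: comp_idl.
- by move=> W a b e; exact: id_pullback_snd e.
- by move=> W h k; rewrite !comp_idl.
Defined.

End Morphisms.

Section Slice.
Variables (C : Category) (Y : C).

Record SliceOb := MkSlice { dom : C; arr : Hom dom Y }.

Record SliceHom (a b : SliceOb) := MkSliceHom {
  mor : Hom (dom a) (dom b);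
  mor_over : arr b ∘ mor = arr a }.

Lemma slice_hom_eq (a b : SliceOb) (h k : SliceHom a b) : mor h = mor k -> h = k.
Proof.
case: h k => [h eh] [k ek] /= hk; case: _ / hk ek => ek.
by rewrite (proof_irrelevance _ eh ek).
Qed.

Lemma slice_id_over (a : SliceOb) : arr a ∘ idm (dom a) = arr a.
Proof. exact: comp_idr. Qed.

Lemma slice_comp_over (a b c : SliceOb) (k : SliceHom b c) (h : SliceHom a b) :
  arr c ∘ (mor k ∘ mor h) = arr a.
Proof. by rewrite comp_assoc !mor_over. Qed.

Definition Slice : Category.
Proof.
refine (@MkCategory SliceOb SliceHom
          (fun a => MkSliceHom (slice_id_over a))
          (fun a b c k h => MkSliceHom (slice_comp_over k h)) _ _ _).
- by move=> a b f; apply: slice_hom_eq; exact: comp_idl.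
- by move=> a b f; apply: slice_hom_eq; exact: comp_idr.
- by move=> a b c d h g f; apply: slice_hom_eq; exact: comp_assoc.
Defined.

End Slice.

Definition FullSub (C : Category) (P : C -> Prop) : Category :=
  @MkCategory {X : C | P X} (fun X Y => Hom (proj1_sig X) (proj1_sig Y))
    (fun X => idm (proj1_sig X)) (fun X Y Z g f => g ∘ f)
    (fun X Y f => comp_idl f) (fun X Y f => comp_idr f)
    (fun W X Y Z h g f => comp_assoc h g f).

(* The functor category from the category with three objects and two composable
   generating arrows. *)
Section Pairs.
Variable C : Category.

Record PairOb := MkPair {
  po0 : C; po1 : C; po2 : C;
  po01 : Hom po0 po1;
  po12 : Hom po1 po2 }.

Record PairHom (a b : PairOb) := MkPairHom {
  ph0 : Hom (po0 a) (po0 b);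
  ph1 : Hom (po1 a) (po1 b);
  ph2 : Hom (po2 a) (po2 b);
  ph01 : ph1 ∘ po01 a = po01 b ∘ ph0;
  ph12 : ph2 ∘ po12 a = po12 b ∘ ph1 }.

Lemma pair_hom_eq (a b : PairOb) (h k : PairHom a b) :
  ph0 h = ph0 k -> ph1 h = ph1 k -> ph2 h = ph2 k -> h = k.
Proof.
case: h k => [h0 h1 h2 e1 e2] [k0 k1 k2 d1 d2] /= q0 q1 q2.
case: _ / q0 d1 => d1; case: _ / q1 d1 d2 => d1 d2; case: _ / q2 d2 => d2.
by rewrite (proof_irrelevance _ e1 d1) (proof_irrelevance _ e2 d2).
Qed.

Definition pair_id (a : PairOb) : PairHom a a.
Proof.
refine (@MkPairHom a a (idm _) (idm _) (idm _) _ _);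
  by rewrite comp_idl comp_idr.
Defined.

Definition pair_comp (a b c : PairOb) (k : PairHom b c) (h : PairHom a b) :
  PairHom a c.
Proof.
refine (@MkPairHom a c (ph0 k ∘ ph0 h) (ph1 k ∘ ph1 h) (ph2 k ∘ ph2 h) _ _).
- by rewrite -comp_assoc ph01 comp_assoc ph01 comp_assoc.
- by rewrite -comp_assoc ph12 comp_assoc ph12 comp_assoc.
Defined.

Definition Pairs : Category.
Proof.
refine (@MkCategory PairOb PairHom pair_id pair_comp _ _ _).
- by move=> a b f; apply: pair_hom_eq; exact: comp_idl.
- by move=> a b f; apply: pair_hom_eq; exact: comp_idr.
- by move=> a b c d h g f; apply: pair_hom_eq; exact: comp_assoc.
Defined.

End Pairs.

Section PullbackFunctor.
Variables (C : Category) (X Y : C) (f : Hom X Y).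

Definition pullback_ob (y : Slice Y) (p : Pullback f (arr y)) : Slice X :=
  MkSlice (pb_fst p).

Lemma pullback_hom_sq (a b : Slice Y) (p : Pullback f (arr a)) (h : Hom a b) :
  f ∘ pb_fst p = arr b ∘ (mor h ∘ pb_snd p).
Proof. by rewrite comp_assoc mor_over pb_sq. Qed.

Definition pullback_hom (a b : Slice Y) (p : Pullback f (arr a))
    (q : Pullback f (arr b)) (h : Hom a b) :
    Hom (pullback_ob p) (pullback_ob q) :=
  @MkSliceHom C X (pullback_ob p) (pullback_ob q)
    (pb_lift q (pullback_hom_sq p h)) (pb_lift_fst q (pullback_hom_sq p h)).

Definition pullback_functor (pb : forall y : Slice Y, Pullback f (arr y)) :
  FunctorOn (fun y => pullback_ob (pb y)).
Proof.
refine (@MkFunctorOn _ _ (fun y => pullback_ob (pb y))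
          (fun a b h => pullback_hom (pb a) (pb b) h) _ _).
- move=> a; apply: slice_hom_eq; apply: pb_ext => /=.
  + by rewrite pb_lift_fst comp_idr.
  + by rewrite pb_lift_snd comp_idl comp_idr.
- move=> a b c k h; apply: slice_hom_eq; apply: pb_ext => /=.
  + by rewrite comp_assoc !pb_lift_fst.
  + by rewrite comp_assoc !pb_lift_snd -!comp_assoc !pb_lift_snd.
Defined.

End PullbackFunctor.

(* X *_Y X over Y, and the diagonal and functoriality of this square. *)
Section Square.
Variables (C : Category) (Y : C).

Definition square_ob (f : Slice Y) (p : Pullback (arr f) (arr f)) : Slice Y :=
  MkSlice (arr f ∘ pb_fst p).

Definition square_proj (i : bool) (f : Slice Y) (p : Pullback (arr f) (arr f)) :
    Hom (pb_ob p) (dom f) :=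
  if i then pb_snd p else pb_fst p.

Definition diagonal (f : Slice Y) (p : Pullback (arr f) (arr f)) :
  Hom f (square_ob p).
Proof.
refine (@MkSliceHom C Y f (square_ob p)
  (pb_lift p (erefl (arr f ∘ idm (dom f)))) _).
by rewrite /= -comp_assoc pb_lift_fst comp_idr.
Defined.

Lemma square_hom_sq (f g : Slice Y) (p : Pullback (arr f) (arr f))
    (h : Hom f g) :
  arr g ∘ (mor h ∘ pb_fst p) = arr g ∘ (mor h ∘ pb_snd p).
Proof. by rewrite !comp_assoc mor_over pb_sq. Qed.

Definition square_hom (f g : Slice Y) (p : Pullback (arr f) (arr f))
    (q : Pullback (arr g) (arr g)) (h : Hom f g) :
  Hom (square_ob p) (square_ob q).
Proof.
refine (@MkSliceHom C Y (square_ob p) (square_ob q)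
          (pb_lift q (square_hom_sq p h)) _).
by rewrite /= -comp_assoc pb_lift_fst comp_assoc mor_over.
Defined.

End Square.

Section DisplayMaps.
Variables (C : Category) (D : MorClass C).

Record is_display_map_category : Prop := {
  dm_terminal : exists T : C, is_terminal T;
  dm_iso : forall (X Y : C) (f : Hom X Y), is_iso f -> D f;
  dm_to_terminal : forall (X T : C) (f : Hom X T), is_terminal T -> D f;
  dm_pullback : forall (X Y Z : C) (f : Hom X Y) (g : Hom Z Y),
    D f -> inhabited (Pullback g f);
  dm_stable : forall (X Y Z : C) (f : Hom X Y) (g : Hom Z Y)
    (p : Pullback g f), D f -> D (pb_fst p) }.

Definition models_Sigma : Prop :=
  forall (X Y Z : C) (g : Hom Y Z) (f : Hom X Y), D g -> D f -> D (g ∘ f).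

Definition models_Pi : Prop :=
  forall (W X Y : C) (g : Hom W X) (f : Hom X Y), D g -> D f ->
  exists P : Slice Y, D (arr P) /\
  exists (pb : forall y : Slice Y, Pullback f (arr y))
    (phi : forall y : Slice Y,
       Hom y P -> Hom (pullback_ob (pb y)) (MkSlice g : Slice X)),
    (forall y, bijective (phi y)) /\
    (forall (y y' : Slice Y) (h : Hom y' y) (k : Hom y P),
       phi y' (k ∘ h) = phi y k ∘ fmor (pullback_functor pb) h).

Section Id.
Variable Y : C.

Record DiagFactorization (f : Slice Y) := MkDiagFactorization {
  df_sq : Pullback (arr f) (arr f);
  df_id : Slice Y;
  df_r : Hom f df_id;
  df_eps : Hom df_id (square_ob df_sq);
  df_diag : df_eps ∘ df_r = diagonal df_sq }.

Lemma df_r_section (f : Slice Y) (F : DiagFactorization f) (i : bool) :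
  square_proj i (df_sq F) ∘ mor (df_eps F) ∘ mor (df_r F) = idm (dom f).
Proof.
rewrite -comp_assoc; have := df_diag F; move/(congr1 (@mor _ _ _ _)) => /= ->.
by case: i; [exact: pb_lift_snd | exact: pb_lift_fst].
Qed.

Definition df_proj (f : Slice Y) (F : DiagFactorization f) (i : bool) :
    Slice (dom f) :=
  MkSlice (square_proj i (df_sq F) ∘ mor (df_eps F)).

Definition df_r_over (f : Slice Y) (F : DiagFactorization f) (i : bool) :
    Hom (MkSlice (idm (dom f)) : Slice (dom f)) (df_proj F i) :=
  @MkSliceHom C (dom f) (MkSlice (idm (dom f))) (df_proj F i)
    (mor (df_r F)) (df_r_section F i).

(* The second conjunct ranges over all choices of the pullback of Id(f) along
   alpha; the pullback of the identity of X along alpha is chosen to be the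
   identity of A, so that the map tested goes from A to alpha^* Id(f). *)
Definition is_Id_type (f : Slice Y) (F : DiagFactorization f) : Prop :=
  D (mor (df_eps F)) /\
  forall (i : bool) (A : C) (alpha : Hom A (dom f))
    (p : Pullback alpha (arr (df_proj F i))),
  llp D (mor (@pullback_hom C A (dom f) alpha (MkSlice (idm (dom f)))
                (df_proj F i) (id_pullback alpha) p (df_r_over F i))).

Definition DSlice : Category := FullSub (C := Slice Y) (fun a => D (arr a)).

(* When D is stable under pullback and closed under composition, fid_sq_D and
   fid_id_D are automatic; they are what makes the factorization a composable
   pair of DSlice rather than of Slice Y. *)
Record FunctorialId := MkFunctorialId {
  fid_fac : forall f : DSlice, DiagFactorization (proj1_sig f);
  fid_is_Id : forall f : DSlice, is_Id_type (fid_fac f);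
  fid_sq_D : forall f : DSlice, D (arr (square_ob (df_sq (fid_fac f))));
  fid_id_D : forall f : DSlice, D (arr (df_id (fid_fac f)));
  fid_pair : DSlice -> Pairs DSlice := fun f =>
    @MkPair DSlice f (exist _ _ (fid_id_D f)) (exist _ _ (fid_sq_D f))
      (df_r (fid_fac f)) (df_eps (fid_fac f));
  fid_functor : FunctorOn fid_pair;
  fid_ph0 : forall (f g : DSlice) (h : Hom f g), ph0 (fmor fid_functor h) = h;
  fid_ph2 : forall (f g : DSlice) (h : Hom f g),
    ph2 (fmor fid_functor h) =
    square_hom (df_sq (fid_fac f)) (df_sq (fid_fac g)) h }.

End Id.

Definition models_Id : Prop :=
  forall (X Y : C) (f : Hom X Y), D f ->
  exists F : DiagFactorization (MkSlice f), is_Id_type F.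

Definition models_functorial_Id : Prop :=
  models_Id /\ forall Y : C, inhabited (FunctorialId Y).

End DisplayMaps.

(* Main.v *)
From Stdlib Require Import IndefiniteDescription.
From Corelib Require Import ssreflect ssrfun.
Require Import Defs.

(** Since every object is fibrant, the identity type of Y factors any f : X -> Y
    as a map of llp D followed by a display map m : M -> Y.  If f lies in the
    closure of D, lifting f against the first factor exhibits f as a retract of m
    over Y, say with section j and retraction s.  Structure on f is then obtained
    by splitting idempotents of the structure on m: pullbacks of f split an
    idempotent of pullbacks of m; Id(f) splits the idempotent Id(j s) of Id(m),
    with Id(h) sandwiched between the splittings (functoriality of Id on D makes
    Id(j s) idempotent and the result functorial); and for Pi-types the presheaf
    to be represented is a retract of a presheaf represented by a display map. *)

Set Implicit Arguments.
Unset Strict Implicit.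
Unset Printing Implicit Defensive.
Local Open Scope cat_scope.

(** * Retracts, splittings and pullbacks *)

(** Existence results are stated in [Prop], while the object part of a functor and a family of
    pullbacks are data; this extracts one choice for each object. *)
Lemma inhabited_choose (A : Type) : inhabited A -> A.
Proof.
move=> h.
have e : exists a : A, True by case: h => a; exists a.
exact: proj1_sig (constructive_indefinite_description _ e).
Qed.

Record Retract (C : Category) (X M : C) := MkRetract {
  rt_sec : Hom X M;
  rt_ret : Hom M X;
  rt_retK : rt_ret ∘ rt_sec = idm X }.

(** By Yoneda the natural idempotent [a ∘ b] of the functor represented by [P] is postcomposition
    with an idempotent of [P], and the splitting of the latter represents [G]. The retraction of [P]
    onto [R] is returned as well, so that closure under retracts can be applied to [R]. *)
Lemma retract_of_representable (C : Category) (hC : cauchy_complete C) (P : C)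
  (F G : C -> Type)
  (Fm : forall y y', Hom y' y -> F y -> F y')
  (Gm : forall y y', Hom y' y -> G y -> G y')
  (phi : forall y, Hom y P -> F y)
  (a : forall y, G y -> F y) (b : forall y, F y -> G y) :
  (forall y, bijective (@phi y)) ->
  (forall y y' (h : Hom y' y) k, phi y' (k ∘ h) = Fm y y' h (phi y k)) ->
  (forall y y' (h : Hom y' y) u, a y' (Gm y y' h u) = Fm y y' h (a y u)) ->
  (forall y y' (h : Hom y' y) u, b y' (Fm y y' h u) = Gm y y' h (b y u)) ->
  (forall y u, b y (a y u) = u) ->
  exists (R : C) (T : Retract R P) (psi : forall y, Hom y R -> G y),
    (forall y, bijective (@psi y)) /\
    (forall y y' (h : Hom y' y) k, psi y' (k ∘ h) = Gm y y' h (psi y k)).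
Proof.
move=> phi_bij phi_nat a_nat b_nat ba.
have phi_inj y : injective (@phi y) by apply: bij_inj.
(* The Yoneda element: [e] corresponds to the value of [a ∘ b] at the identity of [P]. *)
have [e phie] : exists e, phi P e = a P (b P (phi P (idm P))).
  by case: (phi_bij P) => inv _ invK; exists (inv (a P (b P (phi P (idm P))))).
have phi_e y (k : Hom y P) : phi y (e ∘ k) = a y (b y (phi y k)).
  by rewrite phi_nat phie -a_nat -b_nat -phi_nat comp_idl.
have [|R [r [i [eir ri]]]] := hC P e.
  by apply: phi_inj; rewrite phi_e phie ba.
have ei : e ∘ i = i by rewrite eir -comp_assoc ri comp_idr.
exists R, (MkRetract ri), (fun y k => b y (phi y (i ∘ k))); split=> [y|y y' h k].
  have [inv phiK invK] := phi_bij y.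
  exists (fun u => r ∘ inv (a y u)) => [k|u].
    by rewrite -phi_e phiK !comp_assoc -(comp_assoc r) ei ri comp_idl.
  by rewrite comp_assoc -eir phi_e invK !ba.
by rewrite comp_assoc phi_nat b_nat.
Qed.

(** A splitting in [C] lifts to the slice: the middle object gets the structure map [arr a ∘ i], and
    [r] then lies over [Y] because [i ∘ r] does. *)
Lemma slice_cauchy_complete (C : Category) (Y : C) :
  cauchy_complete C -> cauchy_complete (Slice Y).
Proof.
move=> hC a e /(congr1 (@mor _ _ _ _)) /= ee.
have [R [r [i [eir ri]]]] := hC _ _ ee.
have hr : (arr a ∘ i) ∘ r = arr a by rewrite -comp_assoc -eir mor_over.
exists (MkSlice (arr a ∘ i)).
exists (@MkSliceHom C Y a (MkSlice (arr a ∘ i)) r hr).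
exists (@MkSliceHom C Y (MkSlice (arr a ∘ i)) a i erefl).
by split; apply: slice_hom_eq.
Qed.

Lemma mor_comp (C : Category) (Y : C) (a b c : Slice Y) (k : Hom b c)
  (h : Hom a b) : mor (k ∘ h) = mor k ∘ mor h.
Proof. by []. Qed.

Lemma mor_id (C : Category) (Y : C) (a : Slice Y) : mor (idm a) = idm (dom a).
Proof. by []. Qed.

Definition pullback_sym (C : Category) (X Y Z : C) (f : Hom X Z) (g : Hom Y Z)
  (p : Pullback f g) : Pullback g f.
Proof.
by refine (@MkPullback C _ _ _ g f (pb_ob p) (pb_snd p) (pb_fst p)
  (esym (pb_sq p)) (fun W a b e => pb_lift p (esym e)) _ _ _) => *;
  [exact: pb_lift_snd | exact: pb_lift_fst | exact: pb_ext].
Defined.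

(** Describes the map tested in [is_Id_type] by its two projections, so that it can be kept opaque
    afterwards. *)
Lemma id_pullback_hom (C : Category) (A X : C) (alpha : Hom A X) (b : Slice X)
  (p : Pullback alpha (arr b)) (r : Hom (MkSlice (idm X) : Slice X) b)
  (l : Hom A (pb_ob p) :=
    mor (@pullback_hom C A X alpha (MkSlice (idm X)) b (id_pullback alpha) p r)) :
  pb_fst p ∘ l = idm A /\ pb_snd p ∘ l = mor r ∘ alpha.
Proof. by split; [exact: pb_lift_fst | exact: pb_lift_snd]. Qed.

(** * Stability properties of the lifting classes *)

Section Lifting.
Variables (C : Category) (D : MorClass C).

Lemma sub_closure (X Y : C) (m : Hom X Y) : D m -> closure D m.
Proof. by move=> Dm A B l hl; exact: hl. Qed.

(** The closure adds no new lifting condition on the left, so the last clause of [is_Id_type] for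
    the closure can be tested against [D] alone. *)
Lemma llp_closure (A B : C) (l : Hom A B) : llp D l -> llp (closure D) l.
Proof. by move=> hl X Y m hm; exact: hm. Qed.

Lemma closure_iso (X Y : C) (f : Hom X Y) : is_iso f -> closure D f.
Proof.
move=> [g [gf fg]] A B l _ u v e; exists (g ∘ v); split.
- by rewrite -comp_assoc -e comp_assoc gf comp_idl.
- by rewrite comp_assoc fg comp_idl.
Qed.

Lemma closure_comp (X Y Z : C) (g : Hom Y Z) (f : Hom X Y) :
  closure D g -> closure D f -> closure D (g ∘ f).
Proof.
move=> hg hf A B l hl u v e.
have [|d [dl gd]] := hg _ _ l hl (f ∘ u) v; first by rewrite comp_assoc.
have [d' [d'l fd']] := hf _ _ l hl u d (esym dl).
by exists d'; split=> //; rewrite -comp_assoc fd'.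
Qed.

Lemma closure_pullback (X Y Z : C) (f : Hom X Y) (g : Hom Z Y)
  (p : Pullback g f) : closure D f -> closure D (pb_fst p).
Proof.
move=> hf A B l hl u v e.
have [|d [dl fd]] := hf _ _ l hl (pb_snd p ∘ u) (g ∘ v).
  by rewrite comp_assoc -pb_sq -!comp_assoc e.
exists (pb_lift p (esym fd)); split; last exact: pb_lift_fst.
by apply: pb_ext; rewrite comp_assoc ?pb_lift_fst ?pb_lift_snd.
Qed.

(** A lifting problem for [m] is carried to [m'] along the sections, solved there, and the solution
    is brought back by the retraction. *)
Lemma closure_retract (X Y X' Y' : C) (m : Hom X Y) (m' : Hom X' Y')
  (R : Retract X X') (S : Retract Y Y') :
  m' ∘ rt_sec R = rt_sec S ∘ m -> m ∘ rt_ret R = rt_ret S ∘ m' ->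
  closure D m' -> closure D m.
Proof.
move=> es er hm A B l hl u v e.
have [|d [dl md]] := hm _ _ l hl (rt_sec R ∘ u) (rt_sec S ∘ v).
  by rewrite comp_assoc es -!comp_assoc e.
exists (rt_ret R ∘ d); split.
- by rewrite -comp_assoc dl comp_assoc rt_retK comp_idl.
- by rewrite comp_assoc er -comp_assoc md comp_assoc rt_retK comp_idl.
Qed.

Lemma llp_retract_codomain (A B B' : C) (l : Hom A B) (l' : Hom A B')
  (R : Retract B B') :
  rt_sec R ∘ l = l' -> rt_ret R ∘ l' = l -> llp D l' -> llp D l.
Proof.
move=> es er hl' X Y m hm u v e.
have [|d [dl md]] := hl' _ _ m hm u (v ∘ rt_ret R).
  by rewrite -comp_assoc er.
exists (d ∘ rt_sec R); split.
- by rewrite -comp_assoc es.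
- by rewrite comp_assoc md -comp_assoc rt_retK comp_idr.
Qed.

End Lifting.

(** * Functoriality of the fibred square and naturality of the diagonal *)

Section Square.
Variables (C : Category) (Y : C).

Lemma square_ext (f : Slice Y) (p : Pullback (arr f) (arr f)) (W : C)
  (h k : Hom W (pb_ob p)) :
  (forall i, square_proj i p ∘ h = square_proj i p ∘ k) -> h = k.
Proof. by move=> e; apply: pb_ext; [exact: (e false) | exact: (e true)]. Qed.

Lemma square_proj_hom (i : bool) (f g : Slice Y) (p : Pullback (arr f) (arr f))
  (q : Pullback (arr g) (arr g)) (h : Hom f g) :
  square_proj i q ∘ mor (square_hom p q h) = mor h ∘ square_proj i p.
Proof. by case: i; [exact: pb_lift_snd | exact: pb_lift_fst]. Qed.

Lemma square_proj_diagonal (i : bool) (f : Slice Y)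
  (p : Pullback (arr f) (arr f)) :
  square_proj i p ∘ mor (diagonal p) = idm (dom f).
Proof. by case: i; [exact: pb_lift_snd | exact: pb_lift_fst]. Qed.

Lemma square_hom_id (f : Slice Y) (p : Pullback (arr f) (arr f)) :
  square_hom p p (idm f) = idm (square_ob p).
Proof.
apply: slice_hom_eq; apply: square_ext => i.
by rewrite square_proj_hom !mor_id comp_idl comp_idr.
Qed.

Lemma square_hom_comp (f g k : Slice Y) (p : Pullback (arr f) (arr f))
  (q : Pullback (arr g) (arr g)) (r : Pullback (arr k) (arr k))
  (b : Hom g k) (a : Hom f g) :
  square_hom q r b ∘ square_hom p q a = square_hom p r (b ∘ a).
Proof.
apply: slice_hom_eq; apply: square_ext => i.
rewrite !mor_comp comp_assoc square_proj_hom -comp_assoc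
  (square_proj_hom i p q a) square_proj_hom.
by rewrite comp_assoc.
Qed.

Lemma square_hom_diagonal (f g : Slice Y) (p : Pullback (arr f) (arr f))
  (q : Pullback (arr g) (arr g)) (h : Hom f g) :
  square_hom p q h ∘ diagonal p = diagonal q ∘ h.
Proof.
apply: slice_hom_eq; apply: square_ext => i.
rewrite !mor_comp !comp_assoc square_proj_hom -(comp_assoc (mor h)).
by rewrite (square_proj_diagonal i p) (square_proj_diagonal i q) comp_idl comp_idr.
Qed.

End Square.

(** * Factorization through identity types *)

Section Closure.
Variables (C : Category) (D : MorClass C).
Hypotheses (hC : cauchy_complete C) (hD : is_display_map_category D)
  (hSigma : models_Sigma D).

Lemma display_pb_snd (X Y Z : C) (f : Hom X Y) (g : Hom Z Y)
  (p : Pullback f g) : D f -> D (pb_snd p).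
Proof. by move=> Df; exact: dm_stable hD _ _ _ _ _ (pullback_sym p) Df. Qed.

Lemma square_proj_display (Y : C) (f : Slice Y) (p : Pullback (arr f) (arr f))
  (i : bool) : D (arr f) -> D (square_proj i p).
Proof.
move=> Df; case: i; first exact: display_pb_snd.
exact: dm_stable hD _ _ _ _ _ p Df.
Qed.

Section SliceProduct.
Variables (T X Y E : C) (t : Hom Y T) (q : Pullback t t) (e : Hom E (pb_ob q)).
Variables (f : Hom X Y) (XY : Pullback (t ∘ f) t).

Lemma product_map_sq : t ∘ (f ∘ pb_fst XY) = t ∘ pb_snd XY.
Proof. by rewrite comp_assoc pb_sq. Qed.

(** This is [f] times the identity of [Y], from [X ×_T Y] to [Y ×_T Y]; [T] is taken terminal
    later. *)
Definition product_map : Hom (pb_ob XY) (pb_ob q) := pb_lift q product_map_sq.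

Variable p : Pullback product_map e.

Lemma product_pullback_sq :
  f ∘ (pb_fst XY ∘ pb_fst p) = (pb_fst q ∘ e) ∘ pb_snd p.
Proof. by rewrite -(comp_assoc (pb_fst q)) -pb_sq !comp_assoc pb_lift_fst. Qed.

Lemma product_lift_sq W (a : Hom W X) (b : Hom W E) :
  f ∘ a = (pb_fst q ∘ e) ∘ b -> (t ∘ f) ∘ a = t ∘ (pb_snd q ∘ e ∘ b).
Proof. by move=> eab; rewrite -comp_assoc eab !comp_assoc pb_sq. Qed.

Lemma product_pullback_lift_sq W (a : Hom W X) (b : Hom W E)
  (eab : f ∘ a = (pb_fst q ∘ e) ∘ b) :
  product_map ∘ pb_lift XY (product_lift_sq eab) = e ∘ b.
Proof.
apply: pb_ext; rewrite !comp_assoc.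
- by rewrite pb_lift_fst -comp_assoc pb_lift_fst.
- by rewrite !pb_lift_snd.
Qed.

(* The same square as [p], with X x Y -> Y x Y cut down to X -> Y. *)
Definition product_pullback : Pullback f (pb_fst q ∘ e).
Proof.
refine (@MkPullback C _ _ _ f (pb_fst q ∘ e) (pb_ob p)
  (pb_fst XY ∘ pb_fst p) (pb_snd p) product_pullback_sq
  (fun W a b eab => pb_lift p (product_pullback_lift_sq eab)) _ _ _).
- by move=> W a b eab; rewrite -comp_assoc !pb_lift_fst.
- by move=> W a b eab; exact: pb_lift_snd.
- move=> W u v e1 e2; apply: pb_ext => //; apply: pb_ext.
    by rewrite !comp_assoc.
  rewrite -(pb_lift_snd q product_map_sq) -/product_map.
  by rewrite -!comp_assoc !(comp_assoc product_map) pb_sq -!comp_assoc e2.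
Defined.

End SliceProduct.

(* The factorization is X -> X x_Y Id(Y) -> Y, due to Gambino and Garner. *)
Lemma id_factorization (X Y : C) (f : Hom X Y) : models_Id D ->
  exists (M : C) (l : Hom X M) (m : Hom M Y), llp D l /\ D m /\ m ∘ l = f.
Proof.
move=> hId.
have [T hT] := dm_terminal hD; have [t _] := hT Y.
have Dt : D t by exact: dm_to_terminal hD _ _ _ hT.
have [F [Deps hF]] := hId _ _ t Dt.
have [XY] := dm_pullback hD (t ∘ f) Dt.
have [p] := dm_pullback hD (product_map (df_sq F) XY) Deps.
pose p' := product_pullback p.
exists (pb_ob p'); eexists.
exists (pb_snd (df_sq F) ∘ mor (df_eps F) ∘ pb_snd p').
(* The left factor, left open by [eexists], is fixed here as the pullback of the reflexivity map
   along [f]. *)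
split; first exact: (hF false X f p').
split; last first.
  have e := df_r_section F true; rewrite /= in e.
  rewrite -(comp_assoc _ (pb_snd p')) (pb_lift_snd p').
  by rewrite comp_assoc e comp_idl.
(* Seen through [p], the right factor is a pullback of [eps] followed by the projection from [X × Y]
   to [Y]; both are display maps. *)
have -> : pb_snd (df_sq F) ∘ mor (df_eps F) ∘ pb_snd p = pb_snd XY ∘ pb_fst p.
  by rewrite -comp_assoc -pb_sq comp_assoc pb_lift_snd.
apply: hSigma; last exact: dm_stable hD _ _ _ _ _ p Deps.
by apply: display_pb_snd; exact: dm_to_terminal hD _ _ _ hT.
Qed.

(** * Maps of the closure as retracts of display maps, and their pullbacks *)

Hypothesis hId : models_Id D.

Lemma closure_display_retract (Y : C) (f : Slice Y) : closure D (arr f) ->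
  exists m : Slice Y, D (arr m) /\ inhabited (@Retract (Slice Y) f m).
Proof.
move=> hf.
have [M [l [m [hl [Dm ml]]]]] := id_factorization (arr f) hId.
have [|s [sl fs]] := hf _ _ l hl (idm _) m; first by rewrite ml comp_idr.
exists (MkSlice m); split=> //; split.
exists (@MkSliceHom C Y f (MkSlice m) l ml) (@MkSliceHom C Y (MkSlice m) f s fs).
exact: slice_hom_eq.
Qed.

(** Cones over [g] and [arr f] are the cones over [g] and [arr m] fixed by [j ∘ s], hence they are
    represented by the splitting of the induced idempotent of [p]. *)
Lemma pullback_retract (Y Z : C) (g : Hom Z Y) (f m : Slice Y) :
  @Retract (Slice Y) f m -> Pullback g (arr m) -> inhabited (Pullback g (arr f)).
Proof.
move=> [j s /(congr1 (@mor _ _ _ _)) /= sj] p.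
have e1 : g ∘ pb_fst p = arr m ∘ (mor j ∘ mor s ∘ pb_snd p).
  by rewrite !comp_assoc !mor_over pb_sq.
have [|R [r [i [eir ri]]]] := hC (e := pb_lift p e1).
  apply: pb_ext; rewrite comp_assoc ?pb_lift_fst //.
  rewrite pb_lift_snd -comp_assoc pb_lift_snd -!comp_assoc.
  by rewrite (comp_assoc (mor s)) sj comp_idl.
have ei : pb_lift p e1 ∘ i = i by rewrite eir -comp_assoc ri comp_idr.
have sq : g ∘ (pb_fst p ∘ i) = arr f ∘ (mor s ∘ pb_snd p ∘ i).
  by rewrite !comp_assoc mor_over pb_sq.
have e2 W (a : Hom W Z) (b : Hom W (dom f)) :
    g ∘ a = arr f ∘ b -> g ∘ a = arr m ∘ (mor j ∘ b).
  by rewrite comp_assoc mor_over.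
split; refine (@MkPullback C _ _ _ g (arr f) R (pb_fst p ∘ i)
  (mor s ∘ pb_snd p ∘ i) sq (fun W a b e => r ∘ pb_lift p (e2 W a b e)) _ _ _).
- move=> W a b e; rewrite -comp_assoc (comp_assoc i) -eir comp_assoc.
  by rewrite !pb_lift_fst.
- move=> W a b e; rewrite -!comp_assoc (comp_assoc i) -eir (comp_assoc (pb_snd p)).
  rewrite pb_lift_snd -!comp_assoc pb_lift_snd !comp_assoc sj comp_idl.
  by rewrite sj comp_idl.
- move=> W h k h1 h2.
  have hk : i ∘ h = i ∘ k.
    apply: pb_ext; first by rewrite !comp_assoc.
    (* Inserting the idempotent before [i] makes [mor s ∘ pb_snd p ∘ i] appear, on which [h] and [k]
       agree. *)
    rewrite -ei !comp_assoc pb_lift_snd -!comp_assoc.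
    by congr (_ ∘ _); rewrite !comp_assoc.
  by rewrite -(comp_idl h) -(comp_idl k) -ri -!comp_assoc hk.
Qed.

Lemma closure_display_map_category : is_display_map_category (closure D).
Proof.
split.
- exact: dm_terminal hD.
- exact: closure_iso.
- by move=> X T f hT; apply: sub_closure; exact: dm_to_terminal hD _ _ _ hT.
- move=> X Y Z f g hf.
  have [m [Dm [R]]] := @closure_display_retract Y (MkSlice f) hf.
  have [p] := dm_pullback hD g Dm.
  exact: pullback_retract R p.
- by move=> X Y Z f g p; exact: closure_pullback.
Qed.

(** * Functorial identity types for the closure *)

Section FunctorialId.
Variables (Y : C) (FI : FunctorialId D Y).

(** The argument is typed in the slice rather than in [DSlice], so that composites through objects
    outside [D], such as [j ∘ s], are accepted. *)
Definition Id_map (m n : DSlice D Y) (h : Hom (proj1_sig m) (proj1_sig n)) :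
    Hom (df_id (fid_fac FI m)) (df_id (fid_fac FI n)) :=
  ph1 (fmor (fid_functor FI) (h : Hom m n)).

Lemma Id_map_comp (m n o : DSlice D Y) (k : Hom (proj1_sig n) (proj1_sig o))
  (h : Hom (proj1_sig m) (proj1_sig n)) :
  Id_map (m := m) (n := o) (k ∘ h) = Id_map (m := n) k ∘ Id_map h.
Proof.
exact: (congr1 (fun u : PairHom _ _ => ph1 u)
  (fmor_comp (fid_functor FI) (k : Hom n o) (h : Hom m n))).
Qed.

Lemma Id_map_r (m n : DSlice D Y) (h : Hom (proj1_sig m) (proj1_sig n)) :
  Id_map (m := m) (n := n) h ∘ df_r (fid_fac FI m) = df_r (fid_fac FI n) ∘ h.
Proof.
have := ph01 (fmor (fid_functor FI) (h : Hom m n)).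
by rewrite fid_ph0.
Qed.

Lemma Id_map_eps (m n : DSlice D Y) (h : Hom (proj1_sig m) (proj1_sig n)) :
  df_eps (fid_fac FI n) ∘ Id_map (m := m) (n := n) h =
  square_hom (df_sq (fid_fac FI m)) (df_sq (fid_fac FI n)) h
    ∘ df_eps (fid_fac FI m).
Proof.
have := ph12 (fmor (fid_functor FI) (h : Hom m n)).
by rewrite fid_ph2.
Qed.

(* The idempotent of Id(m) induced by the retraction of m onto f need not be an
   identity; its splitting serves as Id(f). *)
Record IdRetract (f : Slice Y) := MkIdRetract {
  ir_sq : Pullback (arr f) (arr f);
  ir_cover : DSlice D Y;
  ir_retract : @Retract (Slice Y) f (proj1_sig ir_cover);
  ir_id : Slice Y;
  ir_id_retract : @Retract (Slice Y) ir_id (df_id (fid_fac FI ir_cover));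
  ir_idempotent : rt_sec ir_id_retract ∘ rt_ret ir_id_retract =
    Id_map (m := ir_cover) (n := ir_cover)
      (rt_sec ir_retract ∘ rt_ret ir_retract) }.

Lemma id_retract_exists (f : Slice Y) :
  closure D (arr f) -> inhabited (IdRetract f).
Proof.
move=> hf; have [m [Dm [R]]] := closure_display_retract hf.
have [sq] := dm_pullback closure_display_map_category (arr f) hf.
pose m' : DSlice D Y := exist _ m Dm.
have [|I [r [i [eir ri]]]] := slice_cauchy_complete hC (Y := Y)
    (e := Id_map (m := m') (n := m') (rt_sec R ∘ rt_ret R)).
  (* Functoriality reduces idempotence of [Id(j s)] to that of [j ∘ s]. *)
  rewrite -Id_map_comp comp_assoc -(comp_assoc (rt_sec R)) rt_retK.
  by rewrite comp_idr.
split; exact: (@MkIdRetract f sq m' R I (MkRetract ri) (esym eir)).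
Qed.

Section Factorization.
Variables (f : Slice Y) (K : IdRetract f).

Let m := ir_cover K.
Let F := fid_fac FI m.
Let j : Hom f (proj1_sig m) := rt_sec (ir_retract K).
Let s : Hom (proj1_sig m) f := rt_ret (ir_retract K).
Let i : Hom (ir_id K) (df_id F) := rt_sec (ir_id_retract K).
Let p : Hom (df_id F) (ir_id K) := rt_ret (ir_id_retract K).

Definition ir_r : Hom f (ir_id K) := p ∘ df_r F ∘ j.
Definition ir_eps : Hom (ir_id K) (square_ob (ir_sq K)) :=
  square_hom (df_sq F) (ir_sq K) s ∘ df_eps F ∘ i.

Lemma ir_sj : s ∘ j = idm f. Proof. exact: rt_retK. Qed.
Lemma ir_pi : p ∘ i = idm (ir_id K). Proof. exact: rt_retK. Qed.
Lemma ir_ip : i ∘ p = Id_map (m := m) (n := m) (j ∘ s).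
Proof. exact: ir_idempotent. Qed.

(** Since [i ∘ p] is [Id(j s)], naturality of the reflexivity map moves [j ∘ s] to its source, where
    [s] cancels against [j]. With the next two lemmas this compares the factorization for [f] with
    that for its cover [m]. *)
Lemma ir_r_sec : i ∘ ir_r = df_r F ∘ j.
Proof.
by rewrite /ir_r !comp_assoc ir_ip Id_map_r -!comp_assoc ir_sj comp_idr.
Qed.

Lemma ir_eps_ret : ir_eps ∘ p = square_hom (df_sq F) (ir_sq K) s ∘ df_eps F.
Proof.
rewrite /ir_eps -(comp_assoc _ i) ir_ip -(comp_assoc _ (df_eps F)) Id_map_eps.
by rewrite comp_assoc square_hom_comp comp_assoc ir_sj comp_idl.
Qed.

Lemma ir_eps_sec :
  square_hom (ir_sq K) (df_sq F) j ∘ ir_eps = df_eps F ∘ i.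
Proof.
rewrite /ir_eps !comp_assoc square_hom_comp -Id_map_eps -ir_ip.
by rewrite -!comp_assoc ir_pi comp_idr.
Qed.

(** The factorization for [m] composes to its diagonal; naturality of the diagonal turns the square
    of [s] into [s], which cancels against [j]. *)
Lemma ir_diag : ir_eps ∘ ir_r = diagonal (ir_sq K).
Proof.
rewrite /ir_r !comp_assoc ir_eps_ret -(comp_assoc _ _ (df_r F)) df_diag.
by rewrite square_hom_diagonal -comp_assoc ir_sj comp_idr.
Qed.

Definition ir_fac : DiagFactorization f :=
  MkDiagFactorization ir_diag.

(** With [ir_proj_ret], this makes each projection from [Id(f)] a retract of the one from [Id(m)],
    lying over the retraction of [m] onto [f]. *)
Lemma ir_proj_sec (b : bool) :
  mor j ∘ arr (df_proj ir_fac b) = arr (df_proj F b) ∘ mor i.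
Proof.
rewrite /= comp_assoc -(square_proj_hom b (ir_sq K) (df_sq F) j).
rewrite -!(comp_assoc (square_proj b (df_sq F))); congr (_ ∘ _).
exact: (congr1 (@mor _ _ _ _) ir_eps_sec).
Qed.

Lemma ir_proj_ret (b : bool) :
  arr (df_proj ir_fac b) ∘ mor p = mor s ∘ arr (df_proj F b).
Proof.
rewrite [RHS]comp_assoc -(square_proj_hom b (df_sq F) (ir_sq K) s).
rewrite -!(comp_assoc (square_proj b (ir_sq K))); congr (_ ∘ _).
exact: (congr1 (@mor _ _ _ _) ir_eps_ret).
Qed.

(** The map [eps] of [f] is a retract of that of [m]. The pullback of the reflexivity map of [f]
    along [alpha] is a retract, with domain [A] fixed, of the pullback for [m] along [j ∘ alpha]. *)
Lemma ir_is_Id : is_Id_type (closure D) ir_fac.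
Proof.
have [Deps hF] := fid_is_Id FI m.
have sj : mor s ∘ mor j = idm (dom f) := congr1 (@mor _ _ _ _) ir_sj.
have pi : mor p ∘ mor i = idm (dom (ir_id K)) := congr1 (@mor _ _ _ _) ir_pi.
split.
{ have eS : mor (square_hom (df_sq F) (ir_sq K) s)
      ∘ mor (square_hom (ir_sq K) (df_sq F) j) = idm (pb_ob (ir_sq K)).
    have := square_hom_comp (ir_sq K) (df_sq F) (ir_sq K) s j.
    rewrite ir_sj square_hom_id.
    exact: (congr1 (@mor _ _ _ _)).
  apply: (@closure_retract C D _ _ _ _ _ (mor (df_eps F))
    (MkRetract pi) (MkRetract eS)).
  - exact: (esym (congr1 (@mor _ _ _ _) ir_eps_sec)).
  - exact: (congr1 (@mor _ _ _ _) ir_eps_ret).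
  - exact: sub_closure. }
move=> b A alpha q; apply: llp_closure.
have Dproj : D (arr (df_proj F b)).
  apply: hSigma => //; apply: square_proj_display; exact: (proj2_sig m).
have [q'] := dm_pullback hD (mor j ∘ alpha) Dproj.
(* These two squares induce the section and the retraction between the pulled back identity types,
   both over [A]. *)
have sq1 : (mor j ∘ alpha) ∘ pb_fst q = arr (df_proj F b) ∘ (mor i ∘ pb_snd q).
  by rewrite -comp_assoc pb_sq (comp_assoc (mor j)) ir_proj_sec -comp_assoc.
have sq2 : alpha ∘ pb_fst q' = arr (df_proj ir_fac b) ∘ (mor p ∘ pb_snd q').
  rewrite comp_assoc ir_proj_ret -comp_assoc -pb_sq !comp_assoc.
  by rewrite sj comp_idl.
have eR : pb_lift q sq2 ∘ pb_lift q' sq1 = idm (pb_ob q).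
  apply: pb_ext; first by rewrite comp_assoc !pb_lift_fst comp_idr.
  rewrite comp_assoc pb_lift_snd -comp_assoc pb_lift_snd comp_assoc comp_idr.
  by rewrite pi comp_idl.
have := id_pullback_hom q (df_r_over ir_fac b).
set l := mor (pullback_hom _ _ _); move=> [l1 l2].
have := id_pullback_hom q' (df_r_over F b).
have := hF b A (mor j ∘ alpha) q'.
set l' := mor (pullback_hom _ _ _); move=> hl' [l1' l2'].
apply: (@llp_retract_codomain C D A _ _ l l' (MkRetract eR)) hl'; apply: pb_ext.
- by rewrite comp_assoc pb_lift_fst l1 l1'.
- have rs : mor i ∘ mor (df_r_over ir_fac b) = mor (df_r_over F b) ∘ mor j.
    exact: (congr1 (@mor _ _ _ _) ir_r_sec).
  by rewrite comp_assoc pb_lift_snd -comp_assoc l2 l2' comp_assoc rs -comp_assoc.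
- by rewrite comp_assoc pb_lift_fst l1 l1'.
- by rewrite comp_assoc pb_lift_snd -comp_assoc l2 l2' /= !comp_assoc.
Qed.

End Factorization.

Section Map.
Variables (f g : Slice Y) (K : IdRetract f) (L : IdRetract g).

Definition ir_lift (h : Hom f g) :
    Hom (proj1_sig (ir_cover K)) (proj1_sig (ir_cover L)) :=
  rt_sec (ir_retract L) ∘ h ∘ rt_ret (ir_retract K).

Definition ir_map (h : Hom f g) : Hom (ir_id K) (ir_id L) :=
  rt_ret (ir_id_retract L) ∘ Id_map (ir_lift h) ∘ rt_sec (ir_id_retract K).

Lemma ir_map_r (h : Hom f g) : ir_map h ∘ ir_r K = ir_r L ∘ h.
Proof.
rewrite /ir_map -comp_assoc ir_r_sec !comp_assoc -(comp_assoc _ _ (df_r _)).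
rewrite Id_map_r /ir_lift /ir_r -!comp_assoc.
by rewrite rt_retK comp_idr.
Qed.

Lemma ir_map_eps (h : Hom f g) :
  ir_eps L ∘ ir_map h = square_hom (ir_sq K) (ir_sq L) h ∘ ir_eps K.
Proof.
rewrite /ir_map !comp_assoc ir_eps_ret -(comp_assoc _ (df_eps _)) Id_map_eps.
rewrite /ir_eps !comp_assoc !square_hom_comp /ir_lift !comp_assoc.
by rewrite rt_retK comp_idl.
Qed.

End Map.

(** The identity lifts to [j ∘ s] on the cover, not to an identity; its image under [Id_map] is the
    split idempotent, which the sandwich cancels. *)
Lemma ir_map_id (f : Slice Y) (K : IdRetract f) :
  ir_map K K (idm f) = idm (ir_id K).
Proof.
rewrite /ir_map /ir_lift comp_idr -ir_idempotent.
by rewrite comp_assoc rt_retK comp_idl rt_retK.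
Qed.

(** Between the two sandwiches stands the idempotent [Id(j s)] of the cover of [g]. It is absorbed,
    since the lift of [a] ends with the section [j] and [s ∘ j] is an identity. *)
Lemma ir_map_comp (f g k : Slice Y) (K : IdRetract f) (L : IdRetract g)
  (N : IdRetract k) (b : Hom g k) (a : Hom f g) :
  ir_map K N (b ∘ a) = ir_map L N b ∘ ir_map K L a.
Proof.
rewrite /ir_map -!comp_assoc (comp_assoc (rt_sec (ir_id_retract L))).
rewrite ir_idempotent; congr (_ ∘ _); rewrite !comp_assoc -!Id_map_comp.
congr (Id_map _ ∘ _); rewrite /ir_lift -!comp_assoc.
by rewrite !(comp_assoc (rt_ret (ir_retract L))) !rt_retK !comp_idl.
Qed.

Definition closure_IdRetract (f : DSlice (closure D) Y) :
    IdRetract (proj1_sig f) :=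
  inhabited_choose (id_retract_exists (proj2_sig f)).

Definition closure_FunctorialId : FunctorialId (closure D) Y.
Proof.
pose K := closure_IdRetract.
have sqD (f : DSlice (closure D) Y) :
    closure D (arr (square_ob (df_sq (ir_fac (K f))))).
  apply: closure_comp; first exact: (proj2_sig f).
  by apply: closure_pullback; exact: (proj2_sig f).
have idD (f : DSlice (closure D) Y) : closure D (arr (df_id (ir_fac (K f)))).
  (* The structure map of [Id(f)] is [eps] followed by the structure map of the square. *)
  rewrite -(mor_over (df_eps (ir_fac (K f)))); apply: closure_comp => //.
  by case: (ir_is_Id (K f)).
pose pair (f : DSlice (closure D) Y) : Pairs (DSlice (closure D) Y) :=
  @MkPair (DSlice (closure D) Y) f
    (exist (fun a : Slice Y => closure D (arr a)) _ (idD f))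
    (exist (fun a : Slice Y => closure D (arr a)) _ (sqD f))
    (df_r (ir_fac (K f))) (df_eps (ir_fac (K f))).
pose pmap (f g : DSlice (closure D) Y) (h : Hom f g) : Hom (pair f) (pair g) :=
  @MkPairHom (DSlice (closure D) Y) (pair f) (pair g) h
    (ir_map (K f) (K g) h)
    (square_hom (df_sq (ir_fac (K f))) (df_sq (ir_fac (K g))) h)
    (ir_map_r (K f) (K g) h) (esym (ir_map_eps (K f) (K g) h)).
have pid f : pmap f f (idm f) = idm (pair f).
  apply: pair_hom_eq => //=; [exact: ir_map_id | exact: square_hom_id].
have pcomp f g k (b : Hom g k) (a : Hom f g) :
    pmap f k (b ∘ a) = pmap g k b ∘ pmap f g a.
  apply: pair_hom_eq => //=; [exact: ir_map_comp|].
  exact: (esym (square_hom_comp _ _ _ _ _)).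
exact: (@MkFunctorialId C (closure D) Y (fun f => ir_fac (K f))
  (fun f => ir_is_Id (K f)) sqD idD (MkFunctorOn pid pcomp)
  (fun f g h => erefl) (fun f g h => erefl)).
Defined.

End FunctorialId.

Lemma closure_functorial_Id :
  (forall Y, inhabited (FunctorialId D Y)) -> models_functorial_Id (closure D).
Proof.
move=> hF.
have cF Y : inhabited (FunctorialId (closure D) Y).
  by case: (hF Y) => FI; split; exact: closure_FunctorialId.
split=> // X Y f hf; have [FI] := cF Y.
pose f' : DSlice (closure D) Y := exist _ (MkSlice f) hf.
by exists (fid_fac FI f'); exact: (fid_is_Id FI f').
Qed.

(** * Dependent products for the closure *)

Section PiRetract.
Variables (W X Y V M : C) (g : Hom W X) (d : Hom V X) (f : Hom X Y) (m : Hom M Y).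
Variables (j : Hom W V) (q : Hom V W) (l : Hom X M) (s : Hom M X).
Hypotheses (dj : d ∘ j = g) (gq : g ∘ q = d) (qj : q ∘ j = idm W).
Hypotheses (ml : m ∘ l = f) (fs : f ∘ s = m) (sl : s ∘ l = idm X).
Variables (v : Pullback s d) (pf : forall y : Slice Y, Pullback f (arr y))
  (pm : forall y : Slice Y, Pullback m (arr y)).

Lemma base_sec_sq (y : Slice Y) : m ∘ (l ∘ pb_fst (pf y)) = arr y ∘ pb_snd (pf y).
Proof. by rewrite comp_assoc ml pb_sq. Qed.

(** With [base_ret], this makes the pullback of [y] along [f] a retract of its pullback along [m],
    naturally in [y]. *)
Definition base_sec (y : Slice Y) : Hom (pb_ob (pf y)) (pb_ob (pm y)) :=
  pb_lift (pm y) (base_sec_sq y).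

Lemma base_ret_sq (y : Slice Y) : f ∘ (s ∘ pb_fst (pm y)) = arr y ∘ pb_snd (pm y).
Proof. by rewrite comp_assoc fs pb_sq. Qed.

Definition base_ret (y : Slice Y) : Hom (pb_ob (pm y)) (pb_ob (pf y)) :=
  pb_lift (pf y) (base_ret_sq y).

Lemma base_retK (y : Slice Y) : base_ret y ∘ base_sec y = idm (pb_ob (pf y)).
Proof.
apply: pb_ext; rewrite comp_assoc comp_idr.
- by rewrite pb_lift_fst -comp_assoc pb_lift_fst comp_assoc sl comp_idl.
- by rewrite !pb_lift_snd.
Qed.

Lemma base_sec_nat (y y' : Slice Y) (h : Hom y' y) :
  base_sec y ∘ mor (fmor (pullback_functor pf) h) =
  (mor (fmor (pullback_functor pm) h) : Hom (pb_ob (pm y')) (pb_ob (pm y)))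
    ∘ base_sec y'.
Proof.
apply: pb_ext; rewrite /= !comp_assoc ?pb_lift_fst ?pb_lift_snd.
- by rewrite -comp_assoc pb_lift_fst.
- by rewrite -comp_assoc pb_lift_snd.
Qed.

Lemma base_ret_nat (y y' : Slice Y) (h : Hom y' y) :
  base_ret y ∘ mor (fmor (pullback_functor pm) h) =
  (mor (fmor (pullback_functor pf) h) : Hom (pb_ob (pf y')) (pb_ob (pf y)))
    ∘ base_ret y'.
Proof.
apply: pb_ext; rewrite /= !comp_assoc ?pb_lift_fst ?pb_lift_snd.
- by rewrite -comp_assoc pb_lift_fst.
- by rewrite -comp_assoc pb_lift_snd.
Qed.

Notation G y := (Hom (pullback_ob (pf y)) (MkSlice g : Slice X)).
Notation F y := (Hom (pullback_ob (pm y)) (MkSlice (pb_fst v) : Slice M)).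

Lemma sections_sec_sq (y : Slice Y) (u : G y) :
  s ∘ pb_fst (pm y) = d ∘ (j ∘ mor u ∘ base_ret y).
Proof. by rewrite !comp_assoc dj (mor_over u) pb_lift_fst. Qed.

(** The cover [d] of [g] lives over [X], while products are formed along [m], with domain [M]; hence
    [d] is pulled back along [s]. A map [u] is transported by [base_ret] on the source and [j] on
    the target; [sections_ret] uses [base_sec] and [q]. *)
Definition sections_sec (y : Slice Y) (u : G y) : F y :=
  @MkSliceHom C M (pullback_ob (pm y)) (MkSlice (pb_fst v))
    (pb_lift v (sections_sec_sq u)) (pb_lift_fst v (sections_sec_sq u)).

Lemma sections_sec_snd (y : Slice Y) (u : G y) :
  pb_snd v ∘ mor (sections_sec u) = j ∘ mor u ∘ base_ret y.
Proof. exact: pb_lift_snd. Qed.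

Lemma sections_ret_over (y : Slice Y) (w : F y) :
  g ∘ (q ∘ pb_snd v ∘ mor w ∘ base_sec y) = pb_fst (pf y).
Proof.
rewrite !comp_assoc gq -pb_sq -(comp_assoc s) (mor_over w) -comp_assoc.
by rewrite pb_lift_fst comp_assoc sl comp_idl.
Qed.

Definition sections_ret (y : Slice Y) (w : F y) : G y :=
  @MkSliceHom C X (pullback_ob (pf y)) (MkSlice g)
    (q ∘ pb_snd v ∘ mor w ∘ base_sec y) (sections_ret_over w).

Lemma sections_retK (y : Slice Y) (u : G y) : sections_ret (sections_sec u) = u.
Proof.
apply: slice_hom_eq => /=; rewrite -(comp_assoc q) pb_lift_snd !comp_assoc qj.
by rewrite comp_idl -comp_assoc base_retK comp_idr.
Qed.

Lemma sections_sec_nat (y y' : Slice Y) (h : Hom y' y) (u : G y) :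
  sections_sec (u ∘ fmor (pullback_functor pf) h) =
  sections_sec u ∘ fmor (pullback_functor pm) h.
Proof.
apply: slice_hom_eq; apply: pb_ext.
- exact: (eq_trans (mor_over (sections_sec (u ∘ _)))
    (esym (mor_over (sections_sec u ∘ fmor (pullback_functor pm) h)))).
- rewrite (sections_sec_snd (u ∘ _)) !mor_comp [RHS]comp_assoc sections_sec_snd.
  rewrite -!comp_assoc; congr (_ ∘ (_ ∘ _)); exact: (esym (base_ret_nat h)).
Qed.

Lemma sections_ret_nat (y y' : Slice Y) (h : Hom y' y) (w : F y) :
  sections_ret (w ∘ fmor (pullback_functor pm) h) =
  sections_ret w ∘ fmor (pullback_functor pf) h.
Proof.
apply: slice_hom_eq; rewrite /= -!comp_assoc; congr (_ ∘ (_ ∘ (_ ∘ _))).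
exact: (esym (base_sec_nat h)).
Qed.

End PiRetract.

(* C/X(f^* -, g) is a retract of C/M(m^* -, s^* d), which is represented by a
   display map. *)
Lemma closure_Pi : models_Pi D -> models_Pi (closure D).
Proof.
move=> hPi W X Y g f hg hf.
have [[V d] [Dd [[[j dj] [q gq] /(congr1 (@mor _ _ _ _)) qj]]]] :=
  @closure_display_retract X (MkSlice g) hg.
have [[M m] [Dm [[[l ml] [s fs] /(congr1 (@mor _ _ _ _)) sl]]]] :=
  @closure_display_retract Y (MkSlice f) hf.
rewrite /= in Dd j dj q gq qj Dm l ml s fs sl.
have [v] := dm_pullback hD s Dd.
have Dv : D (pb_fst v) by exact: dm_stable hD _ _ _ _ _ v Dd.
have [P [DP [pm [phi [phi_bij phi_nat]]]]] := hPi _ _ _ _ _ Dv Dm.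
(* The closure supplies pullbacks of [f] along [arr y]; the legs are then swapped. *)
have pf (y : Slice Y) : Pullback f (arr y).
  apply: inhabited_choose.
  by have [p] := dm_pullback closure_display_map_category (arr y) hf;
    split; exact: pullback_sym p.
have [R [T [psi psiP]]] := @retract_of_representable
  (Slice Y) (slice_cauchy_complete hC) P
  (fun y => Hom (pullback_ob (pm y)) (MkSlice (pb_fst v) : Slice M))
  (fun y => Hom (pullback_ob (pf y)) (MkSlice g : Slice X))
  (fun y y' h w => w ∘ fmor (pullback_functor pm) h)
  (fun y y' h u => u ∘ fmor (pullback_functor pf) h)
  phi (sections_sec dj fs v pm) (fun y w => sections_ret gq ml sl pf w)
  phi_bij phi_nat (sections_sec_nat dj fs v pm)
  (fun y y' h w => sections_ret_nat gq ml sl pf h w)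
  (sections_retK dj gq qj ml fs sl v pm).
exists R; split; last by exists pf, psi.
(* The representing object is a retract of [P] over [Y], so the codomain part of the retract is an
   identity. *)
apply: (@closure_retract C D _ _ _ _ _ (arr P)
  (MkRetract (congr1 (@mor _ _ _ _) (rt_retK T))) (MkRetract (comp_idl (idm Y)))).
- by rewrite /= mor_over comp_idl.
- by rewrite /= mor_over comp_idl.
- exact: sub_closure.
Qed.

End Closure.

Theorem mainTheorem1 (C : Category) (D : MorClass C)
  (hC : cauchy_complete C)
  (hD : is_display_map_category D)
  (hSigma : models_Sigma D)
  (hId : models_functorial_Id D) :
  (is_display_map_category (closure D) /\
   models_Sigma (closure D) /\
   models_functorial_Id (closure D)) /\
  (models_Pi D -> models_Pi (closure D)).
Proof.
have [hId0 hFId] := hId.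
split; last exact: closure_Pi.
split; first exact: closure_display_map_category.
split; last exact: closure_functorial_Id.
by move=> X Y Z g f; exact: closure_comp.
Qed.
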